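(* Let $n\ge 1$, $N\ge 0$, and let $A,B_1,\dots,B_N\in GL(n)$ be invertible $n\times n$ matrices. Then for all integers $l,m_1,\dots,m_N$, $$Z_{l,m_1,\dots,m_N}\left(A,B_1,\dots,B_N\right)=\det(A)\, Z_{n-l-\sum_{i=1}^N m_i,\;m_1,\dots,m_N}\left(A^{-1},A^{-1}B_1,\dots,A^{-1}B_N\right).$$
   Context: Matrices have entries in $\mathbb{R}$ or $\mathbb{C}$, and $I$ is the $n\times n$ identity matrix. For $n\times n$ matrices $X_1,\dots,X_k$, the generalized matrix invariants $Z_{m_1,\dots,m_k}(X_1,\dots,X_k)$ are the coefficients in the polynomial expansion, in the scalar commuting variables $\alpha_1,\dots,\alpha_k$, $$\det\Big(I+\sum_{i=1}^k\alpha_iX_i\Big)=\sum_{m_1,\dots,m_k}\alpha_1^{m_1}\cdots\alpha_k^{m_k}\,Z_{m_1,\dots,m_k}(X_1,\dots,X_k),$$ where the sum is taken over all $(m_1,\dots,m_k)\in\mathbb{Z}^k$, with $Z_{m_1,\dots,m_k}(X_1,\dots,X_k):=0$ whenever the monomial $\alpha_1^{m_1}\cdots\alpha_k^{m_k}$ does not appear in the expansion (in particular whenever some $m_i<0$). *)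

(* Defs.v *)
From HB Require Import structures.
From mathcomp Require Import all_boot all_order all_algebra.
From mathcomp Require Import mpoly.

Set Implicit Arguments.
Unset Strict Implicit.
Unset Printing Implicit Defensive.

Import GRing.Theory.
Local Open Scope ring_scope.

(* det (I + alpha_1 X_1 + ... + alpha_k X_k) as a polynomial in the commuting
   indeterminates alpha_i, here 'X_i. *)
Definition genDet (F : fieldType) (n k : nat) (X : k.-tuple 'M[F]_n) :
    {mpoly F[k]} :=
  \det (1%:M + \sum_(i < k) 'X_i *: map_mx (@mpolyC k F) (tnth X i)).

(* Z_{m_1,...,m_k}(X_1,...,X_k), for exponents m_i in Z. The absolute value only
   turns a nonnegative integer into a natural number. *)
Definition genMatInv (F : fieldType) (n k : nat)
    (m : k.-tuple int) (X : k.-tuple 'M[F]_n) : F :=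
  if [forall i, 0 <= tnth m i] then
    (genDet X)@_[multinom `|tnth m i|%N | i < k]
  else 0.

(* Main.v *)
Require Import Defs.
From HB Require Import structures.
From mathcomp Require Import all_boot all_order all_algebra.
From mathcomp Require Import perm mpoly.

Set Implicit Arguments.
Unset Strict Implicit.
Unset Printing Implicit Defensive.

Import GRing.Theory.
Local Open Scope ring_scope.

(** Since the determinant is multilinear in the columns, Z_{m_1,...,m_k}(X) is
    the sum, over all ways of choosing each column from I, X_1, ..., X_k with
    exactly m_i columns taken from X_i, of the determinant of the matrix so
    assembled.  Multiplying I, A^-1, A^-1 B_i on the left by A gives A, I, B_i:
    this contributes the factor det A to every summand and exchanges the roles
    of the first two matrices in the choice of columns. *)

Definition fiber_card n k (f : {ffun 'I_n -> 'I_k}) (i : 'I_k) : nat :=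
  \sum_(j < n) (f j == i).

Lemma sum_fiber_card n k (f : {ffun 'I_n -> 'I_k}) :
  (\sum_(i < k) fiber_card f i = n)%N.
Proof.
rewrite exchange_big /= -[RHS]card_ord -sum1_card; apply: eq_bigr => j _.
by rewrite (bigD1 (f j)) //= eqxx big1 // => i; rewrite eq_sym => /negPf->.
Qed.

Definition mixed_mx (R : Type) n k (W : 'I_k -> 'M[R]_n)
    (f : {ffun 'I_n -> 'I_k}) : 'M[R]_n :=
  \matrix_(r, j) W (f j) r j.

Lemma mixed_mx_mull (R : pzSemiRingType) n k (A : 'M[R]_n)
    (W : 'I_k -> 'M[R]_n) (f : {ffun 'I_n -> 'I_k}) :
  mixed_mx (fun i => A *m W i) f = A *m mixed_mx W f.
Proof.
by apply/matrixP => r j; rewrite !mxE; apply: eq_bigr => s _; rewrite mxE.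
Qed.

(** Distributing each product of sums in the Leibniz formula leaves one term per choice [f] of a
    matrix for every column. *)
Lemma det_sum_scale (R : comPzRingType) n k (x : 'I_k -> R)
    (W : 'I_k -> 'M[R]_n) :
  \det (\sum_(i < k) x i *: W i) =
  \sum_(f : {ffun 'I_n -> 'I_k}) (\prod_(j < n) x (f j)) * \det (mixed_mx W f).
Proof.
(* The Leibniz formula takes its factors row by row; after transposition they are indexed by the
   columns, as [f] is. *)
rewrite -det_tr.
under [RHS]eq_bigr => f _ do rewrite -det_tr mulr_sumr.
rewrite exchange_big /=; apply: eq_bigr => s _.
under eq_bigr => j _ do rewrite !mxE summxE.
rewrite bigA_distr_bigA mulr_sumr; apply: eq_bigr => f _.
rewrite mulrCA -big_split; congr (_ * _); apply: eq_bigr => j _.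
by rewrite !mxE.
Qed.

Lemma map_mixed_mx (R S : Type) (h : R -> S) n k (W : 'I_k -> 'M[R]_n)
    (f : {ffun 'I_n -> 'I_k}) :
  mixed_mx (fun i => map_mx h (W i)) f = map_mx h (mixed_mx W f).
Proof. by apply/matrixP => r j; rewrite !mxE. Qed.

Lemma genDet_mixed (F : fieldType) n k (X : k.-tuple 'M[F]_n) :
  genDet X =
  \sum_(f : {ffun 'I_n -> 'I_k.+1})
     \det (mixed_mx (tnth (cons_tuple 1%:M X)) f) *:
       'X_[[multinom fiber_card f (lift ord0 i) | i < k]].
Proof.
(* The identity becomes the summand of index [ord0], with coefficient 1, so columns taken from it
   add nothing to the monomial. *)
pose x (i : 'I_k.+1) : {mpoly F[k]} := oapp (fun j => 'X_j) 1 (unlift ord0 i).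
pose W i := map_mx (@mpolyC k F) (tnth (cons_tuple 1%:M X) i).
have -> : genDet X = \det (\sum_(i < k.+1) x i *: W i).
  congr (\det _); rewrite big_ord_recl /x unlift_none scale1r /W tnth0 map_mx1.
  by congr (_ + _); apply: eq_bigr => i _; rewrite liftK tnthS.
rewrite det_sum_scale; apply: eq_bigr => f _.
rewrite map_mixed_mx det_map_mx mulrC mul_mpolyC; congr (_ *: _).
rewrite mpolyXE_id.
under [RHS]eq_bigr => i _ do rewrite mnmE /fiber_card -prodrXr.
(* With the products exchanged, column [j] contributes only the variable selected by [f j], or 1 if
   [f j] is [ord0]. *)
rewrite exchange_big; apply: eq_bigr => j _ /=; rewrite /x.
case: unliftP => [i|] -> /=.
  rewrite (bigD1 i) //= eqxx expr1 big1 ?mulr1 // => i' ni.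
  by rewrite (inj_eq lift_inj) eq_sym (negPf ni).
by rewrite big1 // => i _; rewrite (negPf (neq_lift _ _)).
Qed.

(** Comparing fiber sizes with [m] in the integers covers negative exponents too: no [f] then
    qualifies, and the empty sum is the default value 0. *)
Lemma genMatInv_mixed (F : fieldType) n k (m : k.-tuple int)
    (X : k.-tuple 'M[F]_n) :
  genMatInv m X =
  \sum_(f : {ffun 'I_n -> 'I_k.+1}
        | [forall i : 'I_k, (fiber_card f (lift ord0 i))%:Z == tnth m i])
     \det (mixed_mx (tnth (cons_tuple 1%:M X)) f).
Proof.
rewrite /genMatInv; case: ifPn => [/forallP m_ge0 | /forallPn[i m_lt0]].
  rewrite genDet_mixed raddf_sum [RHS]big_mkcond; apply: eq_bigr => f _ /=.
  rewrite mcoeffZ mcoeffX.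
  suff -> : ([multinom fiber_card f (lift ord0 i) | i < k] ==
      [multinom `|tnth m i|%N | i < k]) =
      [forall i : 'I_k, (fiber_card f (lift ord0 i))%:Z == tnth m i].
    by case: ifP; rewrite ?mulr1 ?mulr0.
  apply/eqP/forallP => [/mnmP e i | e].
    by have := e i; rewrite !mnmE => ->; rewrite gez0_abs.
  by apply/mnmP => i; rewrite !mnmE -(eqP (e i)).
by rewrite big1 // => f /forallP/(_ i)/eqP e; rewrite -e in m_lt0.
Qed.

Theorem mainTheorem1 (F : fieldType) (n N : nat) (hn : (1 <= n)%N)
  (A : 'M[F]_n) (B : N.-tuple 'M[F]_n)
  (hA : A \in unitmx) (hB : forall i : 'I_N, tnth B i \in unitmx)
  (l : int) (m : N.-tuple int) :
  genMatInv (cons_tuple l m) (cons_tuple A B) =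
  \det A * genMatInv
    (cons_tuple (n%:Z - l - \sum_(i < N) tnth m i) m)
    (cons_tuple (invmx A) (map_tuple (mulmx (invmx A)) B)).
Proof.
rewrite !genMatInv_mixed mulr_sumr.
(* Index 0 is the identity, index 1 is [A] or [invmx A], and the later indices, fixed by [s], belong
   to [B]. *)
pose s : {perm 'I_N.+2} := tperm ord0 (lift ord0 ord0).
have s_lift i : s (lift ord0 (lift ord0 i)) = lift ord0 (lift ord0 i).
  by rewrite tpermD.
pose swap (f : {ffun 'I_n -> 'I_N.+2}) := [ffun j => s (f j)].
have swapK : involutive swap by move=> f; apply/ffunP => j; rewrite !ffunE tpermK.
have fiber_swap f i : fiber_card (swap f) i = fiber_card f (s i).
  apply: eq_bigr => j _; rewrite ffunE.
  by rewrite -[i in LHS](tpermK ord0 (lift ord0 ord0)) (inj_eq perm_inj).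
rewrite (reindex_inj (inv_inj swapK)) /=; apply: eq_big => [f | f _].
  (* The fiber sizes add up to [n]. Once those of index at least 2 are given by [m], size [l] at
     index 0 means size [n - l - \sum_i m_i] at index 1. *)
  have := sum_fiber_card f; rewrite !big_ord_recl => n_eq.
  have forall_ord_recl (P : pred 'I_N.+1) :
      [forall i, P i] = P ord0 && [forall i, P (lift ord0 i)].
    apply/forallP/andP => [P_all | [P0 /forallP P_lift] i].
      by split=> //; apply/forallP => i.
    by case: (unliftP ord0 i) => [j|] ->.
  rewrite !forall_ord_recl !tnth0 fiber_swap tpermR.
  under eq_forallb => i do rewrite fiber_swap s_lift tnthS.
  under [in RHS]eq_forallb => i do rewrite tnthS.
  rewrite ![_ && [forall _, _]]andbC; apply: andb_id2l => /forallP m_eq.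
  under eq_bigr => i _ do rewrite -(eqP (m_eq i)).
  rewrite -(big_morph Posz PoszD (erefl _)) addrAC.
  rewrite eq_sym [RHS]eq_sym !subr_eq -(congr1 Posz n_eq) !PoszD.
  by rewrite addrA (inj_eq (addIr _)) addrC (inj_eq (addrI _)) eq_sym.
rewrite -det_mulmx -mixed_mx_mull; congr (\det _).
apply/matrixP => r j; rewrite [LHS]mxE [RHS]mxE ffunE; congr (fun_of_matrix _ _ _).
case: (unliftP ord0 (f j)) => [i|] ->; last first.
  by rewrite tpermL tnthS !tnth0 mulmx1.
case: (unliftP ord0 i) => [i'|] ->.
  by rewrite s_lift !tnthS tnth_map mulKVmx.
by rewrite tpermR tnthS !tnth0 mulmxV.
Qed.
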